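(* Let $G$ be an infinite amenable group and let $G=A_1\cup\dots\cup A_n$ be a partition of $G$ into $n$ cells. Then there exist a cell $A_i$ and a finite subset $F\subseteq G$ with $|F|\leqslant n$ such that $G=F\Delta(A_i)$.
   Context: For $A\subseteq G$, $\Delta(A)=\{g\in G:|gA\cap A|=\infty\}$. A group is amenable if it admits a left invariant Banach measure, i.e. a finitely additive left invariant probability measure defined on all subsets of $G$. *)

(* Defs.v *)
From mathcomp Require Import all_boot all_order all_algebra.
From mathcomp Require Import finmap.
From mathcomp Require Import boolp classical_sets functions cardinality reals.

Set Implicit Arguments.
Unset Strict Implicit.
Unset Printing Implicit Defensive.

Local Open Scope classical_set_scope.
Local Open Scope ring_scope.

Definition ltranslate (G : groupType) (g : G) (A : set G) : set G :=
  [set (g * a)%g | a in A].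

Definition setprod (G : groupType) (F B : set G) : set G :=
  [set (f * b)%g | f in F & b in B].

Definition Delta (G : groupType) (A : set G) : set G :=
  [set g : G | infinite_set (ltranslate g A `&` A)].

Record left_invariant_Banach_measure (R : realType) (G : groupType)
    (m : set G -> R) : Prop := {
  Banach_ge0 : forall A : set G, 0 <= m A;
  Banach_total : m [set: G] = 1;
  Banach_additive : forall A B : set G,
    A `&` B = set0 -> m (A `|` B) = m A + m B;
  Banach_left_invariant : forall (g : G) (A : set G), m (ltranslate g A) = m A
}.

Definition amenable (R : realType) (G : groupType) : Prop :=
  exists m : set G -> R, left_invariant_Banach_measure m.

(* Main.v *)
Require Import Defs.
From mathcomp Require Import all_boot all_order all_algebra.
From mathcomp Require Import finmap.
From mathcomp Require Import boolp classical_sets functions cardinality reals.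
From mathcomp Require Import lra.

(** Some cell [A i] has measure at least [1/n]. Finite sets are null, since [G]
    is infinite, so translates of [A i] with pairwise finite intersections pack
    like disjoint sets and there are at most [n] of them. If [F] indexes a
    largest such family then every [g A i] meets some [f A i] with [f \in F] in
    an infinite set, which says that [f^-1 g] lies in [Delta (A i)]. *)

Import Order.TTheory GRing.Theory Num.Theory.

Local Open Scope classical_set_scope.

Section Translates.
Context {G : groupType}.
Implicit Types (g h : G) (A B : set G).

Lemma ltranslateE g A x : ltranslate g A x <-> A (g^-1 * x)%g.
Proof.
split=> [[a Aa <-]|Ax]; first by rewrite mulKg.
by exists (g^-1 * x)%g => //; rewrite mulVKg.
Qed.

Lemma ltranslateM g h A : ltranslate (g * h)%g A = ltranslate g (ltranslate h A).
Proof.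
by apply/seteqP; split=> x; rewrite !ltranslateE invgM mulgA.
Qed.

Lemma ltranslateI g A B :
  ltranslate g (A `&` B) = ltranslate g A `&` ltranslate g B.
Proof. by apply/seteqP; split=> x; rewrite /setI /= !ltranslateE. Qed.

Lemma ltranslateVK g A : ltranslate g^-1%g (ltranslate g A) = A.
Proof. by apply/seteqP; split=> x; rewrite !ltranslateE invgK mulKg. Qed.

Lemma infinite_ltranslate g A : infinite_set A -> infinite_set (ltranslate g A).
Proof.
move=> infA finA; apply: infA.
by rewrite -(ltranslateVK g A); apply: finite_image.
Qed.

(** Left translation by [f^-1] is injective and commutes with intersections, so it carries the given
    set onto the intersection of [A] with its translate by [f^-1 * g], keeping it infinite. *)
Lemma Delta_divg f g A :
  infinite_set (ltranslate g A `&` ltranslate f A) -> Delta A (f^-1 * g)%g.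
Proof.
move=> /(@infinite_ltranslate f^-1%g).
by rewrite ltranslateI ltranslateVK -ltranslateM.
Qed.

End Translates.

Section BanachMeasure.
Local Open Scope ring_scope.
Context {R : realType} {G : groupType} {m : set G -> R}.
Hypothesis mP : left_invariant_Banach_measure m.
Implicit Types A B : set G.

Lemma Banach_set0 : m set0 = 0.
Proof.
have := Banach_additive mP (set0I (set0 : set G)); rewrite setU0; lra.
Qed.

Lemma Banach_setID A B : m A = m (A `&` B) + m (A `\` B).
Proof.
rewrite -(Banach_additive mP) ?setUIDK //.
by apply/seteqP; split=> // x [[_ Bx] [_ /(_ Bx)]].
Qed.

Lemma le_Banach A B : A `<=` B -> m A <= m B.
Proof.
move=> /setIidPr AB; rewrite (Banach_setID B A) AB lerDl.
exact: Banach_ge0.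
Qed.

Lemma Banach_le1 A : m A <= 1.
Proof. by rewrite -(Banach_total mP); apply: le_Banach. Qed.

Lemma Banach_setUD A B : m (A `|` B) = m A + m (B `\` A).
Proof.
rewrite -(Banach_additive mP) ?setDIK //.
by rewrite setUDr setDv setD0.
Qed.

Lemma le_Banach_setU A B : m (A `|` B) <= m A + m B.
Proof. by rewrite Banach_setUD lerD2l; apply: le_Banach; apply: subDsetl. Qed.

Lemma Banach_setU_null A B : m (A `&` B) = 0 -> m (A `|` B) = m A + m B.
Proof.
by move=> AB0; rewrite Banach_setUD (Banach_setID B A) setIC AB0 add0r.
Qed.

Lemma le_Banach_bigsetU {I : Type} (s : seq I) (A : I -> set G) :
  m (\big[setU/set0]_(i <- s) A i) <= \sum_(i <- s) m (A i).
Proof.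
elim: s => [|i s IHs]; first by rewrite !big_nil Banach_set0.
by rewrite !big_cons (le_trans (le_Banach_setU _ _)) ?lerD2l.
Qed.

Lemma Banach_bigsetU_null {I : eqType} (s : seq I) (A : I -> set G) :
  {in s, forall i, m (A i) = 0} -> m (\big[setU/set0]_(i <- s) A i) = 0.
Proof.
move=> A0; apply/eqP; rewrite eq_le (Banach_ge0 mP) andbT.
by rewrite (le_trans (le_Banach_bigsetU _ _)) ?big_seq ?big1.
Qed.

(** Null overlaps do not affect additivity, so by invariance the union of the translates has measure
    [size s] times [m A], and no set exceeds the total mass 1. It is used twice: with a singleton
    for [A], to show that points are null, and with a cell of the partition. *)
Lemma Banach_packing (s : seq G) (A : set G) : uniq s ->
  {in s &, forall f g, f != g -> m (ltranslate f A `&` ltranslate g A) = 0} ->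
  (size s)%:R * m A <= 1.
Proof.
move=> s_uniq s_null.
suff <- : m (\big[setU/set0]_(f <- s) ltranslate f A) = (size s)%:R * m A.
  exact: Banach_le1.
elim: s s_uniq s_null => [|f s IHs] /=.
  by rewrite big_nil Banach_set0 mul0r.
move=> /andP[fNs s_uniq] s_null.
rewrite big_cons Banach_setU_null.
  rewrite (Banach_left_invariant mP) IHs // => [|g h gs hs].
    by rewrite -natr1 mulrDl mul1r addrC.
  by apply: s_null; rewrite inE ?gs ?hs orbT.
(* The first translate meets the union of the others in a finite union of pairwise overlaps, each of
   them null. *)
rewrite -bigcup_seq setI_bigcupr bigcup_seq Banach_bigsetU_null // => g gs.
apply: s_null; rewrite ?mem_head // ?inE ?gs ?orbT //.
by apply: contraNneq fNs => ->.
Qed.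

Hypothesis G_infinite : infinite_set [set: G].

(** By invariance all points have the same mass. Were it positive, more points than its inverse
    would pack into total mass 1. *)
Lemma Banach_set1 (x : G) : m [set x] = 0.
Proof.
have -> : m [set x] = m [set 1%g].
  rewrite -(Banach_left_invariant mP x [set 1%g]); congr m.
  by rewrite /ltranslate image_set1 mulg1.
apply/eqP; rewrite eq_le (Banach_ge0 mP) andbT leNgt; apply/negP => m1_gt0.
have [X _ X_large] := @infinite_set_fset _ _
  (Num.bound (m [set 1%g])^-1) G_infinite.
have : #|` X|%:R * m [set 1%g] <= 1.
  apply: Banach_packing => [|f g _ _ fg]; first exact: fset_uniq.
  rewrite /ltranslate !image_set1 !mulg1 (_ : _ `&` _ = set0) ?Banach_set0 //.
  by apply/seteqP; split=> // y [/= -> /eqP]; apply/negP.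
apply/negP; rewrite -ltNge -ltr_pdivrMr // div1r.
rewrite (lt_le_trans (archi_boundP _)) ?ler_nat //.
by rewrite invr_ge0 ltW.
Qed.

Lemma Banach_finite (A : set G) : finite_set A -> m A = 0.
Proof.
move=> /finite_fsetP[X ->].
(* The finite set is rewritten as the union of its singletons. *)
rewrite -[ [set` X] ]image_id -bigcup_imset1 bigcup_seq.
by apply: Banach_bigsetU_null => x _; apply: Banach_set1.
Qed.

End BanachMeasure.

(** By subadditivity the measures of the [n] cells sum to at least 1, so they cannot all be below
    [1/n]. The product form avoids dividing by [n]. *)
Lemma exists_large_cell {R : realType} {G : groupType} {m : set G -> R}
    {n : nat} {A : 'I_n -> set G} :
  left_invariant_Banach_measure m -> \bigcup_i A i = [set: G] ->
  exists i, (1 <= n%:R * m (A i))%R.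
Proof.
move=> mP covA; apply: contrapT => /forallNP A_small.
have : (1 <= \sum_(i < n) m (A i))%R.
  rewrite -(Banach_total mP) -covA.
  rewrite (_ : [set: 'I_n] = [set` index_enum 'I_n]).
    by rewrite bigcup_seq; apply: le_Banach_bigsetU.
  by apply/seteqP; split=> // i _; rewrite /= mem_index_enum.
(* For [n = 0] the empty sum would be at least 1. A positive [n] allows cancelling it and makes the
   termwise strict comparison of sums strict. *)
case: n => [|n] in A covA A_small *; first by rewrite big_ord0 ler10.
apply/negP; rewrite -ltNge -(ltr_pM2l (ltr0Sn R n)) mulr1 mulr_sumr.
rewrite [ltRHS](_ : _ = \sum_(i < n.+1) 1)%R; last first.
  by rewrite sumr_const card_ord.
apply: ltr_sum => [|i _]; last by rewrite ltNge; apply/negP/A_small.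
by apply/hasP; exists ord0; first exact: mem_index_enum.
Qed.

Theorem theorem4p1 (R : realType) (G : groupType)
    (G_infinite : infinite_set [set: G]) (G_amenable : amenable R G)
    (n : nat) (A : 'I_n -> set G)
    (A_partition : classical_sets.partition [set: 'I_n] A [set: G]) :
  exists (i : 'I_n) (F : {fset G}),
    (#|` F| <= n)%N /\ [set: G] = setprod [set` F] (Delta (A i)).
Proof.
have [m mP] := G_amenable.
have [covA _ _] := A_partition.
have [i Ai_large] := exists_large_cell mP covA.
have Ai_gt0 : (0 < m (A i))%R.
  rewrite lt_neqAle (Banach_ge0 mP) andbT; apply/eqP => Ai0.
  by move: Ai_large; rewrite -Ai0 mulr0 ler10.
pose almost_disjoint (F : {fset G}) := {in F &, forall f g, f != g ->
  finite_set (ltranslate f (A i) `&` ltranslate g (A i))}.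
(* Packing gives [#|F| * m (A i) <= 1 <= n * m (A i)], and the positive factor [m (A i)] cancels. *)
have F_small F : almost_disjoint F -> (#|` F| <= n)%N.
  move=> adF; rewrite -(ler_nat R) -(ler_pM2r Ai_gt0).
  apply: le_trans Ai_large; apply: (Banach_packing mP) => [|f g fF gF fg].
    exact: fset_uniq.
  by apply: (Banach_finite mP G_infinite); apply: adF.
pose P k := `[< exists2 F, almost_disjoint F & #|` F| = k >].
have exP : exists k, P k.
  exists 0%N; apply/asboolP; exists fset0; last exact: cardfs0.
  by move=> f g; rewrite inE.
have ubP k : P k -> (k <= n)%N by move=> /asboolP[F adF <-]; apply: F_small.
case: (ex_maxnP exP ubP) => _ /asboolP[F adF <-] F_max.
exists i, F; split; first exact: F_small.
apply/seteqP; split=> // g _.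
suff [f fF infg] : exists2 f, f \in F &
    infinite_set (ltranslate g (A i) `&` ltranslate f (A i)).
  exists f => //; exists (f^-1 * g)%g; first exact: Delta_divg.
  by rewrite mulVKg.
(* If [g] is in [F], take [f = g]: the cell has positive measure, hence is infinite. *)
have [gF|gNF] := boolP (g \in F).
  exists g => //; rewrite setIid; apply: infinite_ltranslate => finA.
  by rewrite (Banach_finite mP G_infinite _ finA) ltxx in Ai_gt0.
apply: contrapT => gF_finite.
have {}gF_finite f : f \in F ->
    finite_set (ltranslate g (A i) `&` ltranslate f (A i)).
  by move=> fF; apply: contrapT => infg; apply: gF_finite; exists f.
(* Otherwise adjoining [g] to [F] would give a strictly larger almost disjoint family, against
   maximality. *)
have := F_max (#|` (g |` F)%fset|); rewrite cardfsU1 gNF ltnn => /(_ _)/negP.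
apply=> //; apply/asboolP; exists (g |` F)%fset; last by rewrite cardfsU1 gNF.
move=> f h; rewrite !inE => /orP[/eqP->|fF] /orP[/eqP->|hF].
- by rewrite eqxx.
- by move=> _; apply: gF_finite.
- by move=> _; rewrite setIC; apply: gF_finite.
- exact: adF.
Qed.
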